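(* Suppose $(T,q,t,w)$ is basic data with invertible corners. Then the $2$-graph $\Lambda(T,q,t,w)$ is $1$-coaligned if and only if $w(\mathbf{0})$ is invertible in $\mathbb{Z}/q\mathbb{Z}$.
   Context: $\mathbb{N}=\{0,1,2,\dots\}$; $\mathbf{0}$ is the zero vector of $\mathbb{N}^2$, $e_1,e_2$ are the standard generators of $\mathbb{N}^2$, and $\le$ on $\mathbb{N}^2$ is the coordinatewise order with join $\vee$. $k$-graph: a $k$-graph is a pair $(\Lambda,d)$ consisting of a countable category $\Lambda$ and a functor $d:\Lambda\to\mathbb{N}^k$ (degree map; $\mathbb{N}^k$ is regarded as a monoid under addition) such that for every $\lambda\in\Lambda$ and $m,n\in\mathbb{N}^k$ with $d(\lambda)=m+n$ there are unique $\mu,\nu\in\Lambda$ with $d(\mu)=m$, $d(\nu)=n$ and $\lambda=\mu\nu$. Here $\mu\nu$ is defined when $s(\mu)=r(\nu)$, with $r,s$ the range and source; $\Lambda^n:=\{\lambda: d(\lambda)=n\}$. $1$-coaligned: a $k$-graph $\Lambda$ is $1$-coaligned if for all $1\le i,j\le k$ with $i\ne j$ and all $(e^i,e^j)\in\Lambda^{e_i}\times\Lambda^{e_j}$ with $s(e^i)=s(e^j)$ there exists a unique pair $(f^i,f^j)\in\Lambda^{e_i}\times\Lambda^{e_j}$ such that $f^ie^j=f^je^i$. Basic data $(T,q,t,w)$: a finite (nonempty) hereditary subset $T\subset\mathbb{N}^2$, the tile (hereditary: $j\in T$ and $\mathbf{0}\le i\le j$ imply $i\in T$); an alphabet $\{0,\dots,q-1\}$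 identified with $\mathbb{Z}/q\mathbb{Z}$; an element $t$ of the alphabet, the trace; and a function $w:T\to\{0,\dots,q-1\}$, the rule. Write $(c_1,c_2):=\bigvee\{i: i\in T\}$; it is assumed that $c_1,c_2>0$. The rule has invertible corners if $w(c_1e_1)$ and $w(c_2e_2)$ are invertible in $\mathbb{Z}/q\mathbb{Z}$. The $2$-graph $\Lambda(T,q,t,w)$ (for basic data with invertible corners): the vertex set is $$\Lambda^0=\Big\{v:T\to\mathbb{Z}/q\mathbb{Z}\ \Big|\ \sum_{i\in T}w(i)v(i)\equiv t \pmod q\Big\}.$$ For $S\subset\mathbb{Z}^2$ and $n\in\mathbb{Z}^2$, $S+n=\{i+n:i\in S\}$; for $n\in\mathbb{N}^2$, $T(n):=\bigcup_{\mathbf{0}\le m\le n}(T+m)$. If $f:S\to\mathbb{Z}/q\mathbb{Z}$ with $T+n\subset S\subset\mathbb{N}^2$, then $f|_{T+n}:T\to\mathbb{Z}/q\mathbb{Z}$ denotes $i\mapsto f(i+n)$. A path of degree $n$ is a function $\lambda:T(n)\to\mathbb{Z}/q\mathbb{Z}$ such that $\lambda|_{T+m}$ is a vertex for all $\mathbf{0}\le m\le n$; its source is $s(\lambda)=\lambda|_{T+n}$ and its range is $r(\lambda)=\lambda|_T$. For $\lambda\in\Lambda^p$ and $\mathbf{0}\le m\le n\le p$, the segment $\lambda(m,n)$ is the path of degree $n-m$ given by $\lambda(m,n)(i)=\lambda(m+i)$ for $i\in T(n-m)$. For $\mu\in\Lambda^m$, $\nu\in\Lambda^n$ with $s(\mu)=r(\nu)$,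 the composite $\mu\nu$ is the unique path $\lambda\in\Lambda^{m+n}$ with $\lambda(\mathbf{0},m)=\mu$ and $\lambda(m,m+n)=\nu$ (existence and uniqueness hold because of the invertible corners, and this makes $\Lambda(T,q,t,w)$ a $2$-graph; these are known facts). *)

(* Defs.v *)
From HB Require Import structures.
From mathcomp Require Import all_boot all_order all_algebra.
From mathcomp Require Import finmap zify.

Set Implicit Arguments.
Unset Strict Implicit.
Unset Printing Implicit Defensive.

Import GRing.Theory.

Local Open Scope fset_scope.
Local Open Scope ring_scope.

(* N^k, with the pointwise addition and zero of finite functions. *)
Notation NN k := {ffun 'I_k -> nat}.

Definition unitv {k} (i : 'I_k) : NN k := [ffun j => (j == i) : nat].

Definition lev {k} (m n : NN k) : bool := [forall j, (m j <= n j)%N].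

Definition subv {k} (n m : NN k) : NN k := [ffun j => (n j - m j)%N].

(* The composition is a total function, but only its values on composable
   pairs, i.e. pairs with [src mu = rng nu], are meaningful: no law says
   anything about the others.  Countability of the category is carried by the
   countType structures. *)
Record kgraph (k : nat) := KGraph {
  obj : countType;
  mor : countType;
  src : mor -> obj;
  rng : mor -> obj;
  idm : obj -> mor;
  comp : mor -> mor -> mor;
  deg : mor -> NN k;
  src_idm : forall v, src (idm v) = v;
  rng_idm : forall v, rng (idm v) = v;
  src_comp : forall mu nu, src mu = rng nu -> src (comp mu nu) = src nu;
  rng_comp : forall mu nu, src mu = rng nu -> rng (comp mu nu) = rng mu;
  comp_idl : forall mu, comp (idm (rng mu)) mu = mu;
  comp_idr : forall mu, comp mu (idm (src mu)) = mu;
  comp_assoc : forall la mu nu, src la = rng mu -> src mu = rng nu ->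
    comp la (comp mu nu) = comp (comp la mu) nu;
  deg_idm : forall v, deg (idm v) = 0;
  deg_comp : forall mu nu, src mu = rng nu ->
    deg (comp mu nu) = deg mu + deg nu;
  unique_factorization : forall la m n, deg la = m + n ->
    exists! p : mor * mor,
      [/\ deg p.1 = m, deg p.2 = n, src p.1 = rng p.2 & la = comp p.1 p.2]
}.

Arguments src {k _}.
Arguments rng {k _}.
Arguments idm {k _}.
Arguments comp {k _}.
Arguments deg {k _}.

Definition one_coaligned (k : nat) (G : kgraph k) : Prop :=
  forall i j : 'I_k, i != j ->
  forall ei ej : mor G, deg ei = unitv i -> deg ej = unitv j ->
    src ei = src ej ->
  exists! f : mor G * mor G,
    [/\ deg f.1 = unitv i, deg f.2 = unitv j,
        src f.1 = rng ej, src f.2 = rng ei & comp f.1 ej = comp f.2 ei].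

Definition tile_join (T : {fset NN 2}) : NN 2 :=
  [ffun j => \max_(i : T) val i j].

(* Z/qZ is represented by 'I_q with congruences modulo q, so that every q >= 1
   is covered; [trace] forces q to be positive. *)
Record basic_data := BasicData {
  tile : {fset NN 2};
  tile_neq0 : tile != fset0;
  tile_hereditary : forall i j, j \in tile -> lev i j -> i \in tile;
  tile_join_gt0 : forall j, (0 < tile_join tile j)%N;
  modulus : nat;
  trace : 'I_modulus;
  rule : {ffun tile -> 'I_modulus}
}.

Definition invertible_mod (q : nat) (a : 'I_q) : Prop :=
  exists b : 'I_q, (a * b = 1 %[mod q])%N.

Definition corner (D : basic_data) (j : 'I_2) : NN 2 :=
  unitv j *+ tile_join (tile D) j.

Lemma levP k (m n : NN k) : reflect (forall j, (m j <= n j)%N) (lev m n).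
Proof. exact: forallP. Qed.

Lemma zero_in_tile (D : basic_data) : 0 \in tile D.
Proof.
have /fset0Pn [x xT] := tile_neq0 D.
by apply: (tile_hereditary xT); apply/levP => j; rewrite ffunE.
Qed.

Lemma cornerE (D : basic_data) j l :
  corner D j l = if l == j then tile_join (tile D) j else 0%N.
Proof.
rewrite /corner ffunMnE ffunE; case: eqP => _ /=.
  by elim: (tile_join _ _) => // n IHn; rewrite mulrS IHn.
by rewrite mul0rn.
Qed.

Lemma corner_in_tile (D : basic_data) (j : 'I_2) : corner D j \in tile D.
Proof.
have T0 := zero_in_tile D.
have: (0 < #|{: tile D}|)%N by apply/card_gt0P; exists [` T0].
case/(eq_bigmax (fun i : tile D => val i j)) => x xE.
apply: (tile_hereditary (valP x)); apply/levP => l.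
by rewrite cornerE; case: eqP => [->|//]; rewrite ffunE xE.
Qed.

Definition invertible_corners (D : basic_data) : Prop :=
  forall j : 'I_2, invertible_mod (rule D [` corner_in_tile D j]).

(* The finite set of all m <= n, see [in_box]. *)
Definition box (n : NN 2) : {fset NN 2} :=
  [fset ([ffun j : 'I_2 => if j == ord0 then a else b] : NN 2)
    | a in iota 0 (n ord0).+1, b in iota 0 (n ord_max).+1].

(* T(n) *)
Definition tile_at (D : basic_data) (n : NN 2) : {fset NN 2} :=
  [fset i + m | i in tile D, m in box n].

(* A function on S as a function on N^2, by an arbitrary value off S. *)
Definition ev (D : basic_data) (S : {fset NN 2}) (f : {ffun S -> 'I_(modulus D)})
    (p : NN 2) : 'I_(modulus D) :=
  oapp f (trace D) (insub p).

Definition is_vertex (D : basic_data) (v : {ffun tile D -> 'I_(modulus D)}) : bool :=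
  (\sum_(i : tile D) rule D i * v i == trace D %[mod modulus D])%N.

Definition vertex (D : basic_data) := {v : {ffun tile D -> 'I_(modulus D)} | is_vertex v}.

Definition labelling (D : basic_data) :=
  {n : NN 2 & {ffun tile_at D n -> 'I_(modulus D)}}.

(* la|_{T + m}; meaningful for m <= tag la. *)
Definition restrict (D : basic_data) (la : labelling D) (m : NN 2) :
    {ffun tile D -> 'I_(modulus D)} :=
  [ffun i => ev (tagged la) (val i + m)].

Definition is_path (D : basic_data) (la : labelling D) : bool :=
  [forall m : box (tag la), is_vertex (restrict la (val m))].

Definition tpath (D : basic_data) := {la : labelling D | is_path la}.

(* la(m, n); meaningful for m <= n <= tag la. *)
Definition segment (D : basic_data) (la : labelling D) (m n : NN 2) :
    labelling D :=
  Tagged (fun n => {ffun tile_at D n -> 'I_(modulus D)})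
    [ffun i : tile_at D (subv n m) => ev (tagged la) (m + val i)].

Definition path_deg (D : basic_data) (la : tpath D) : NN 2 := tag (val la).

(* The composite of mu and nu is the path la with la(0,m) = mu and
   la(m,m+n) = nu, where m and n are the degrees of mu and nu. *)
Definition is_composite (D : basic_data) (mu nu la : labelling D) : bool :=
  [&& tag la == tag mu + tag nu,
      segment la 0 (tag mu) == mu
    & segment la (tag mu) (tag mu + tag nu) == nu].

Lemma in_box (n m : NN 2) : (m \in box n) = lev m n.
Proof.
apply/idP/levP.
  case/imfset2P => a Ha [b Hb ->] j.
  have {}Ha : a \in iota 0 (n ord0).+1 by [].
  have {}Hb : b \in iota 0 (n ord_max).+1 by [].
  move: Ha Hb; rewrite !mem_iota !ffunE => Ha Hb.
  case: eqP => [->|]; first by lia.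
  case: j => [[|[|//]] j2] /eqP // _.
  have -> : Ordinal j2 = ord_max by apply/val_inj.
  lia.
move=> le_mn; apply/imfset2P; exists (m ord0).
  by change (m ord0 \in iota 0 (n ord0).+1); rewrite mem_iota /= ltnS.
exists (m ord_max).
  by change (m ord_max \in iota 0 (n ord_max).+1); rewrite mem_iota /= ltnS.
apply/ffunP => j; rewrite ffunE; case: eqP => [->//|].
case: j => [[|[|//]] j2] /eqP // _.
by congr (m _); apply/val_inj.
Qed.

Lemma N2P (m n : NN 2) : m ord0 = n ord0 -> m ord_max = n ord_max -> m = n.
Proof.
move=> e0 e1; apply/ffunP => -[[|[|//]] j2].
  by rewrite (_ : Ordinal j2 = ord0) //; apply/val_inj.
by rewrite (_ : Ordinal j2 = ord_max) //; apply/val_inj.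
Qed.

Lemma lev2 (m n : NN 2) :
  lev m n = (m ord0 <= n ord0)%N && (m ord_max <= n ord_max)%N.
Proof.
apply/levP/andP => [H|[H0 H1] j]; first by split.
case: j => [[|[|//]] j2].
  by rewrite (_ : Ordinal j2 = ord0) //; apply/val_inj.
by rewrite (_ : Ordinal j2 = ord_max) //; apply/val_inj.
Qed.

Lemma addvE k (m n : NN k) j : (m + n) j = (m j + n j)%N.
Proof. by rewrite ffunE. Qed.

Lemma subvE k (m n : NN k) j : (subv m n) j = (m j - n j)%N.
Proof. by rewrite ffunE. Qed.

Lemma zerovE k j : (0 : NN k) j = 0%N.
Proof. by rewrite ffunE. Qed.

Definition vE := (addvE, subvE, zerovE).

Lemma tile_atP (D : basic_data) (n p : NN 2) :
  reflect (exists m, [/\ lev m n, lev m p & subv p m \in tile D])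
          (p \in tile_at D n).
Proof.
apply: (iffP (imfset2P _ _ _ _ _)) => /=.
  case=> i iT [m mn ->]; exists m; split; first by rewrite -in_box.
    by rewrite lev2 !vE !leq_addl.
  suff -> : subv (i + m) m = i by [].
  by apply/ffunP => j; rewrite !vE addnK.
case=> m [mn mp pT]; exists (subv p m) => //; exists m; first by rewrite in_box.
by apply/ffunP => j; rewrite !vE subnK //; apply/levP.
Qed.

Lemma tile_atD (D : basic_data) (n m i : NN 2) :
  i \in tile D -> lev m n -> i + m \in tile_at D n.
Proof. by move=> iT mn; apply/imfset2P; exists i => //; exists m; rewrite //= in_box. Qed.
Section Facts.
Variable D : basic_data.
Local Notation T := (tile D).
Local Notation q := (modulus D).
Local Notation c := (tile_join T).

Implicit Types (la mu nu : labelling D) (F G : NN 2 -> 'I_q) (a b i m n p : NN 2).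

Let at_ la p := ev (tagged la) p.

Let constr F a := (\sum_(i : T) rule D i * F (val i + a)%R == trace D %[mod q])%N.

Let mk n F : labelling D :=
  Tagged (fun n => {ffun tile_at D n -> 'I_q}) [ffun i : tile_at D n => F (val i)].

Lemma evE (S : {fset NN 2}) (f : {ffun S -> 'I_q}) p (pS : p \in S) :
  ev f p = f [` pS].
Proof. by rewrite /ev insubT. Qed.

Lemma ev_out (S : {fset NN 2}) (f : {ffun S -> 'I_q}) p :
  p \notin S -> ev f p = trace D.
Proof. by move=> pS; rewrite /ev insubF //; apply/negbTE. Qed.

Lemma at_mk n F p : p \in tile_at D n -> at_ (mk n F) p = F p.
Proof. by move=> pn; rewrite /at_ evE ffunE. Qed.

Lemma at_seg la m n p : p \in tile_at D (subv n m) ->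
  at_ (segment la m n) p = at_ la (m + p).
Proof. by move=> pn; rewrite /at_ evE ffunE. Qed.

Lemma lab_eq la mu : tag la = tag mu ->
  (forall p, p \in tile_at D (tag la) -> at_ la p = at_ mu p) -> la = mu.
Proof.
case: la mu => [n f] [n' g] /= nn'; case: n' / nn' g => g H.
congr existT; apply/ffunP => -[p pn].
by have := H p pn; rewrite /at_ /= !evE.
Qed.

Lemma constr_ext F G a :
  (forall i, i \in T -> F (i + a) = G (i + a)) -> constr F a = constr G a.
Proof.
move=> FG; rewrite /constr; congr (_ %% _ == _)%N.
by apply: eq_bigr => i _; rewrite FG // (valP i).
Qed.

Lemma constrE la m : is_vertex (restrict la m) = constr (at_ la) m.
Proof.
rewrite /is_vertex /constr; congr (_ %% _ == _)%N.
by apply: eq_bigr => i _; rewrite ffunE.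
Qed.

Lemma is_pathP la :
  reflect (forall m, lev m (tag la) -> constr (at_ la) m) (is_path la).
Proof.
apply: (iffP forallP) => H.
  by move=> m mn; have := mn; rewrite -in_box => mb; have := H [` mb]; rewrite constrE.
by case=> m mb; rewrite constrE; apply: H; rewrite -in_box.
Qed.

Lemma addv_eq m n a : (m + a == n + a) = (m == n).
Proof.
apply/eqP/eqP => [/ffunP E|->//]; apply/ffunP => j.
by have := E j; rewrite !vE; apply: addIn.
Qed.

Lemma lev_refl n : lev n n.
Proof. by apply/levP. Qed.

Lemma lev_trans m n p : lev m n -> lev n p -> lev m p.
Proof. rewrite !lev2 => /andP[a1 a2] /andP[b1 b2]; lia. Qed.

Lemma lev0 n : lev 0 n.
Proof. by rewrite lev2 !vE. Qed.

Lemma lev_addr m n : lev m (m + n).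
Proof. rewrite lev2 !vE; lia. Qed.

Lemma subvK m n : lev m n -> m + subv n m = n.
Proof. rewrite lev2 => /andP[a1 a2]; apply: N2P; rewrite !vE; lia. Qed.

Lemma addvK m n : subv (m + n) m = n.
Proof. apply: N2P; rewrite !vE; lia. Qed.

Lemma subv0 n : subv n 0 = n.
Proof. apply: N2P; rewrite !vE; lia. Qed.

Lemma tile_at_shift m n p : p \in tile_at D n -> m + p \in tile_at D (m + n).
Proof.
case/tile_atP => b [bn bp pT]; apply/tile_atP; exists (m + b); split.
- move: bn; rewrite !lev2 !vE; lia.
- move: bp; rewrite !lev2 !vE; lia.
- suff -> : subv (m + p) (m + b) = subv p b by [].
  by apply: N2P; rewrite !vE; lia.
Qed.

Lemma tile_at_le m n p : lev m n -> p \in tile_at D m -> p \in tile_at D n.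
Proof.
move=> mn /tile_atP [b [bn bp pT]]; apply/tile_atP; exists b; split => //.
exact: lev_trans mn.
Qed.

Lemma tile_at0 p : (p \in tile_at D 0) = (p \in T).
Proof.
apply/tile_atP/idP.
  case=> m [m0 mp pT]; suff <- : subv p m = p by [].
  move: m0; rewrite lev2 !vE => /andP[a1 a2].
  apply: N2P; rewrite !vE; lia.
by move=> pT; exists 0; rewrite lev_refl lev0 subv0.
Qed.

Lemma segment_path la m n : is_path la -> lev m n -> lev n (tag la) ->
  is_path (segment la m n).
Proof.
move=> /is_pathP Hla mn nla; apply/is_pathP => a /= an.
rewrite (_ : constr _ a = constr (at_ la) (m + a)).
  apply: Hla; apply: lev_trans nla.
  move: an mn; rewrite !lev2 !vE => /andP[a1 a2] /andP[b1 b2]; lia.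
rewrite /constr; congr (_ %% _ == _)%N; apply: eq_bigr => i _.
rewrite at_seg; last by apply: tile_atD => //; apply: valP.
by rewrite addrCA.
Qed.

Lemma is_compositeP mu nu la :
  reflect [/\ tag la = tag mu + tag nu,
              forall p, p \in tile_at D (tag mu) -> at_ la p = at_ mu p
            & forall p, p \in tile_at D (tag nu) ->
                at_ la (tag mu + p) = at_ nu p]
          (is_composite mu nu la).
Proof.
apply: (iffP and3P) => -[].
  move=> /eqP tE /eqP s1 /eqP s2; split => // p pn.
    by rewrite -{1}s1 at_seg ?subv0 // add0r.
  by rewrite -{1}s2 at_seg // addvK.
move=> tE H1 H2; split; first exact/eqP.
  apply/eqP/lab_eq; rewrite /= ?subv0 // => p pn.
  by rewrite at_seg ?subv0 // add0r H1.
apply/eqP/lab_eq; rewrite /= ?addvK // => p pn.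
by rewrite at_seg ?addvK // H2.
Qed.

Lemma tile_bound i j : i \in T -> (i j <= c j)%N.
Proof.
move=> iT; rewrite ffunE.
exact: (leq_bigmax (F := fun x : T => val x j) [` iT]).
Qed.

Lemma tile_down i p : i \in T -> lev p i -> p \in T.
Proof. exact: tile_hereditary. Qed.

Lemma column_in_tile j p : (forall l, l != j -> p l = 0%N) -> (p j <= c j)%N ->
  p \in T.
Proof.
move=> p0 pj; apply: tile_down (corner_in_tile D j) _; apply/levP => l.
by rewrite cornerE; case: eqP => [->//|/eqP/p0->].
Qed.

Lemma solve_mod (x : 'I_q) (r t : nat) : invertible_mod x ->
  exists b : 'I_q, (x * b + r = t %[mod q])%N.
Proof.
case=> u xu; have q0 : (0 < q)%N by case: (trace D) => ?; lia.
exists (Ordinal (ltn_pmod (u * (t + (q - r %% q))) q0)) => /=.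
rewrite -modnDml modnMmr modnDml mulnA -modnDml -modnMml xu modnMml mul1n modnDml.
rewrite -modnDmr -addnA subnK ?modnDr //.
by rewrite ltnW // ltn_pmod.
Qed.

Lemma cancel_mod (x b b' : 'I_q) (r : nat) : invertible_mod x ->
  (x * b + r = x * b' + r %[mod q])%N -> b = b'.
Proof.
case=> u xu /eqP; rewrite eqn_modDr => /eqP E; apply/val_inj => /=.
have H (y : 'I_q) : (y = u * (x * y) %% q :> nat)%N.
  by rewrite mulnA (mulnC u) -modnMml xu modnMml mul1n modn_small.
by rewrite (H b) (H b') -modnMmr E modnMmr.
Qed.

(* Constraints over translates T + a can be solved one after the other when
   the corner point of each of them avoids all the earlier translates. *)
Section Fill.
Hypothesis inv : invertible_corners D.
Variable piv : NN 2 -> 'I_2.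
Let pt a := corner D (piv a) + a.
Let ordered a b := [forall i : T, val i + a != pt b].

Lemma fill_one F a : exists G,
  constr G a /\ forall p, p != pt a -> G p = F p.
Proof.
set x := rule D [` corner_in_tile D (piv a)].
set r := (\sum_(i : T | i != [` corner_in_tile D (piv a)])
             rule D i * F (val i + a)%R)%N.
have [b bE] := solve_mod r (trace D) (inv (piv a)).
exists (fun p => if p == pt a then b else F p); split; last first.
  by move=> p /negbTE ->.
rewrite /constr (bigD1 [` corner_in_tile D (piv a)]) //= eqxx.
apply/eqP; rewrite -bE; congr ((_ + _) %% _)%N.
apply: eq_bigr => i; rewrite /pt addv_eq => /negbTE ni.
by rewrite (_ : (val i == _) = false) // -ni -val_eqE.
Qed.

Lemma fill_exists s F : pairwise ordered s -> exists G,
  (forall a, a \in s -> constr G a) /\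
  (forall p, (forall a, a \in s -> p != pt a) -> G p = F p).
Proof.
elim/last_ind: s => [|s b IHs]; first by exists F.
rewrite pairwise_rcons => /andP[/allP sb /IHs [G [G1 G2]]].
have [H [H1 H2]] := fill_one G b; exists H; split.
  move=> a; rewrite mem_rcons inE => /orP[/eqP->//|as_].
  rewrite (@constr_ext _ G); first exact: G1.
  by move=> i iT; apply: H2; have /forallP/(_ [` iT]) := sb a as_.
move=> p Hp; rewrite H2; last by apply: Hp; rewrite mem_rcons inE eqxx.
by apply: G2 => a as_; apply: Hp; rewrite mem_rcons inE as_ orbT.
Qed.

Lemma fill_unique s F G : pairwise ordered s ->
  (forall a, a \in s -> constr F a) -> (forall a, a \in s -> constr G a) ->
  (forall p, (forall a, a \in s -> p != pt a) -> G p = F p) -> G =1 F.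
Proof.
elim: s => [|b s IHs]; first by move=> _ _ _ H p; apply: H.
rewrite pairwise_cons => /andP[/allP sb so] FC GC GF.
apply: IHs => //; try by move=> a as_; rewrite ?FC ?GC // inE as_ orbT.
move=> p Hp; have [pE|pb] := eqVneq p (pt b); last first.
  by apply: GF => a; rewrite inE => /orP[/eqP->|/Hp].
have others i : i \in T -> i != corner D (piv b) -> G (i + b) = F (i + b).
  move=> iT ib; apply: GF => a; rewrite inE => /orP[/eqP->|as_].
    by rewrite /pt addv_eq.
  by have /forallP/(_ [` iT]) := sb a as_.
have gb : b \in b :: s by rewrite inE eqxx.
have /eqP f := FC b gb; have /eqP g := GC b gb; have fg := etrans g (esym f).
move: fg; rewrite (bigD1 [` corner_in_tile D (piv b)]) //=.
rewrite [in X in _ = X -> _](bigD1 [` corner_in_tile D (piv b)]) //= -/(pt b) -pE.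
rewrite (eq_bigr (fun i : T => rule D i * F (val i + b)%R)%N).
  exact: (cancel_mod (inv (piv b))).
by move=> i; rewrite -val_eqE => ib; rewrite others //; exact: valP.
Qed.

End Fill.

Section Compose.
Hypothesis inv : invertible_corners D.
Variables mu nu : labelling D.
Hypotheses (mu_path : is_path mu) (nu_path : is_path nu).
Hypothesis src_rng : restrict mu (tag mu) = restrict nu 0.
Let m := tag mu.
Let n := tag nu.

Let piv (a : NN 2) : 'I_2 := if (a ord0 < m ord0)%N then ord_max else ord0.
Let rank (a : NN 2) : nat :=
  if (a ord0 < m ord0)%N then (a ord_max * (m ord0).+1 + (m ord0 - a ord0))%N
  else (a ord0 * (m ord_max).+1 + (m ord_max - a ord_max))%N.
(* The translates of T(m + n) that belong to neither factor. *)
Let cells := sort (fun a b => rank a <= rank b)%N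
  [seq a <- enum_fset (box (m + n)) | ~~ lev a m && ~~ lev m a].
Let ordered a b := [forall i : T, val i + a != corner D (piv b) + b].

Lemma mem_cells a :
  (a \in cells) = [&& lev a (m + n), ~~ lev a m & ~~ lev m a].
Proof.
by rewrite mem_sort mem_filter andbC -[a \in enum_fset _]/(a \in box _) in_box.
Qed.

Lemma lex_lt (x y z w k : nat) : (x < y)%N -> (z <= k)%N ->
  (x * k.+1 + z < y * k.+1 + w)%N.
Proof. by move=> xy zk; have := leq_mul xy (leqnn k.+1); lia. Qed.

Lemma rank_lt a b i : a \in cells -> b \in cells -> i \in T ->
  i + a = corner D (piv b) + b -> b = a \/ (rank b < rank a)%N.
Proof.
rewrite !mem_cells => /and3P[an am ma] /and3P[bn bm mb] iT /ffunP E.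
have := E ord0; have := E ord_max; rewrite !vE !cornerE /piv /rank.
have := tile_bound ord0 iT; have := tile_bound ord_max iT.
move: an am ma bn bm mb; rewrite !lev2 !vE.
move=> an am ma bn bm mb i1 i0.
case: (ltnP (b ord0) (m ord0)) => b0 /=; case: (ltnP (a ord0) (m ord0)) => a0 e1 e0.
- have [l|] := ltnP (b ord_max) (a ord_max).
    by right; apply: lex_lt; lia.
  move=> l; have e : a ord_max = b ord_max by lia.
  have [l0|l0] := ltnP (a ord0) (b ord0); first by right; rewrite e; lia.
  by left; apply: N2P; lia.
- exfalso; lia.
- exfalso; lia.
- have [l|] := ltnP (b ord0) (a ord0).
    by right; apply: lex_lt; lia.
  move=> l; have e : a ord0 = b ord0 by lia.
  have [l0|l0] := ltnP (a ord_max) (b ord_max); first by right; rewrite e; lia.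
  by left; apply: N2P; lia.
Qed.

Lemma cells_ordered : pairwise ordered cells.
Proof.
have tr : transitive (fun a b => rank a <= rank b)%N.
  by move=> x y z; apply: leq_trans.
have so : sorted (fun a b => rank a <= rank b)%N cells.
  by apply: sort_sorted => x y; apply: leq_total.
have un : uniq cells by rewrite sort_uniq filter_uniq // fset_uniq.
rewrite sorted_pairwise // in so; rewrite uniq_pairwise in un.
have H : pairwise (fun a b => (rank a <= rank b)%N && (a != b)) cells.
  by rewrite pairwise_relI so un.
apply: (sub_in_pairwise _ _ H (P := mem cells)); last by apply/allP.
move=> a b ac bc /andP[rab nab]; apply/forallP => i; apply/eqP => E.
case: (rank_lt ac bc (valP i) E) => [ba|]; first by rewrite ba eqxx in nab.
by rewrite ltnNge rab.
Qed.

Lemma pivot_out a : a \in cells ->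
  corner D (piv a) + a \notin tile_at D m /\
  ~~ (lev m (corner D (piv a) + a) &&
      (subv (corner D (piv a) + a) m \in tile_at D n)).
Proof.
rewrite mem_cells !lev2 !vE /piv => /and3P[an am ma].
case: (ltnP (a ord0) (m ord0)) => a0; rewrite !cornerE /=; split; try lia.
- apply/negP => /tile_atP [b [bm bp /(tile_bound ord_max)]].
  move: bm bp; rewrite !lev2 !vE !cornerE /=; lia.
- apply/negP => /tile_atP [b [bm bp /(tile_bound ord0)]].
  move: bm bp; rewrite !lev2 !vE !cornerE /=; lia.
Qed.

Lemma new_point p : p \in tile_at D (m + n) -> p \notin tile_at D m ->
  ~~ (lev m p && (subv p m \in tile_at D n)) ->
  exists2 a, a \in cells & p = corner D (piv a) + a.
Proof.
move=> /tile_atP[a [amn ap pT]] pm pn.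
have am : ~~ lev a m.
  by apply: contra pm => am; apply/tile_atP; exists a.
have ma : ~~ lev m a.
  apply: contra pn => ma.
  rewrite (lev_trans ma ap) /=; apply/tile_atP; exists (subv a m); split.
  - move: amn; rewrite !lev2 !vE; lia.
  - move: ap; rewrite !lev2 !vE; lia.
  - suff -> : subv (subv p m) (subv a m) = subv p a by [].
    by move: ma ap; rewrite !lev2 => ma ap; apply: N2P; rewrite !vE; lia.
have sT := pT; have b1 := tile_bound ord_max pT; have b0 := tile_bound ord0 pT.
rewrite !vE in b0 b1; move: amn am ma (ap); rewrite !lev2 !vE => amn am ma ap'.
have [a0|a0] := ltnP (a ord0) (m ord0).
  have p0 : (p ord0 < m ord0)%N.
    rewrite ltnNge; apply: contra pn => mp0.
    rewrite lev2 mp0 (_ : (m ord_max <= p ord_max)%N) /=; last lia.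
    pose b : NN 2 := [ffun j => if j == ord0 then 0%N else (a ord_max - m ord_max)%N].
    apply/tile_atP; exists b; split.
    - rewrite lev2 /b !ffunE /=; lia.
    - rewrite lev2 /b !ffunE /=; lia.
    - apply: tile_down sT _; rewrite lev2 /b !ffunE /=; lia.
  have p1 : (m ord_max + c ord_max < p ord_max)%N.
    rewrite ltnNge; apply: contra pm => le1.
    pose b : NN 2 := [ffun j => if j == ord0 then p ord0 else (p ord_max - c ord_max)%N].
    apply/tile_atP; exists b; split.
    - rewrite lev2 /b [X in (X <= _)%N]ffunE [X in _ && (X <= _)%N]ffunE /=; lia.
    - rewrite lev2 /b [X in (X <= _)%N]ffunE [X in _ && (X <= _)%N]ffunE /=; lia.
    - apply: (@column_in_tile ord_max).
        case=> [[|[|//]] l2] // _.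
        by rewrite (_ : Ordinal l2 = ord0) ?vE /b ?ffunE /=; [lia|apply/val_inj].
      by rewrite vE /b [X in (_ - X <= _)%N]ffunE /=; lia.
  pose b : NN 2 := [ffun j => if j == ord0 then p ord0 else (p ord_max - c ord_max)%N].
  have bE0 : b ord0 = p ord0 by rewrite ffunE.
  have bE1 : b ord_max = (p ord_max - c ord_max)%N by rewrite ffunE.
  exists b; first by rewrite mem_cells !lev2 !vE bE0 bE1; lia.
  by apply: N2P; rewrite vE cornerE /piv bE0 p0 ?bE0 ?bE1 /=; clear -p0 p1; lia.
have a1 : (a ord_max < m ord_max)%N by lia.
have p1 : (p ord_max < m ord_max)%N.
  rewrite ltnNge; apply: contra pn => mp1.
  rewrite lev2 mp1 (_ : (m ord0 <= p ord0)%N) /=; last lia.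
  pose b : NN 2 := [ffun j => if j == ord0 then (a ord0 - m ord0)%N else 0%N].
  apply/tile_atP; exists b; split.
  - rewrite lev2 /b !ffunE /=; lia.
  - rewrite lev2 /b !ffunE /=; lia.
  - apply: tile_down sT _; rewrite lev2 /b !ffunE /=; lia.
have p0 : (m ord0 + c ord0 < p ord0)%N.
  rewrite ltnNge; apply: contra pm => le1.
  pose b : NN 2 := [ffun j => if j == ord0 then (p ord0 - c ord0)%N else p ord_max].
  have bE0 : b ord0 = (p ord0 - c ord0)%N by rewrite ffunE.
  have bE1 : b ord_max = p ord_max by rewrite ffunE.
  apply/tile_atP; exists b; split; try by rewrite lev2 bE0 bE1; lia.
  apply: (@column_in_tile ord0).
    case=> [[|[|//]] l2] // _.
    by rewrite (_ : Ordinal l2 = ord_max) ?vE ?bE1 ?subnn //; apply/val_inj.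
  by rewrite vE bE0; lia.
pose b : NN 2 := [ffun j => if j == ord0 then (p ord0 - c ord0)%N else p ord_max].
have bE0 : b ord0 = (p ord0 - c ord0)%N by rewrite ffunE.
have bE1 : b ord_max = p ord_max by rewrite ffunE.
exists b; first by rewrite mem_cells !lev2 !vE bE0 bE1; lia.
by apply: N2P; rewrite vE cornerE /piv ltnNge bE0 (_ : (m ord0 <= _)%N) ?bE1 /=; clear -p0 p1; lia.
Qed.

Lemma composite_exists : exists2 la, is_path la & is_composite mu nu la.
Proof.
pose F p := if p \in tile_at D m then at_ mu p else at_ nu (subv p m).
have Fmu p : p \in tile_at D m -> F p = at_ mu p by rewrite /F => ->.
have Fnu p : p \in tile_at D n -> F (m + p) = at_ nu p.
  rewrite /F addvK => pn; case: ifP => // /tile_atP[b [bm bp sT]].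
  have pT : p \in T.
    apply: tile_down sT _; move: bm bp; rewrite !lev2 !vE; lia.
  have /ffunP/(_ [` pT]) := src_rng.
  by rewrite !ffunE /= addr0 addrC.
have [G [G1 G2]] := fill_exists inv F cells_ordered.
have Gmu p : p \in tile_at D m -> G p = at_ mu p.
  move=> pm; rewrite -Fmu //; apply: G2 => a /pivot_out [H _].
  by apply: contraNneq H => <-.
have Gnu p : p \in tile_at D n -> G (m + p) = at_ nu p.
  move=> pn; rewrite -Fnu //; apply: G2 => a /pivot_out [_ H].
  by apply: contraNneq H => <-; rewrite addvK pn lev_addr.
exists (mk (m + n) G).
  apply/is_pathP => a /= amn.
  rewrite (@constr_ext _ G); last by move=> i iT; rewrite at_mk // tile_atD.
  have [am|am] := boolP (lev a m).
    rewrite (@constr_ext _ (at_ mu)); first exact: (is_pathP _ mu_path).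
    by move=> i iT; rewrite Gmu // tile_atD.
  have [ma|ma] := boolP (lev m a); last by apply: G1; rewrite mem_cells amn am.
  have le : lev (subv a m) n by move: amn; rewrite !lev2 !vE; lia.
  have := (is_pathP _ nu_path) _ le; rewrite /constr.
  congr (_ %% _ == _)%N; apply: eq_bigr => i _.
  rewrite -Gnu; last by apply: tile_atD => //; apply: valP.
  by rewrite addrCA subvK.
apply/is_compositeP; split => //= p pn.
  by rewrite at_mk ?Gmu //; apply: tile_at_le pn; apply: lev_addr.
by rewrite at_mk ?Gnu //; apply: tile_at_shift.
Qed.

Lemma composite_unique la la' : is_path la -> is_path la' ->
  is_composite mu nu la -> is_composite mu nu la' -> la = la'.
Proof.
move=> /is_pathP pla /is_pathP pla' /is_compositeP[t1 m1 n1] /is_compositeP[t2 m2 n2].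
apply: lab_eq => [|p _]; first by rewrite t1 t2.
move: p; apply: (fill_unique inv cells_ordered).
- by move=> a; rewrite mem_cells => /and3P[amn _ _]; apply: pla'; rewrite t2.
- by move=> a; rewrite mem_cells => /and3P[amn _ _]; apply: pla; rewrite t1.
move=> p Hp.
have [pmn|pmn] := boolP (p \in tile_at D (m + n)); last first.
  by rewrite /at_ !ev_out // ?t1 ?t2.
have [pm|pm] := boolP (p \in tile_at D m); first by rewrite m1 // m2.
have [/andP[mp pn]|pn] := boolP (lev m p && (subv p m \in tile_at D n)).
  by rewrite -(subvK mp) n1 // n2.
by have [a /Hp + pE] := new_point pmn pm pn; rewrite pE eqxx.
Qed.

End Compose.

End Facts.

Section Graph.
Variable D : basic_data.
Local Notation T := (tile D).
Local Notation q := (modulus D).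

Implicit Types (la mu nu : tpath D) (v : vertex D).

Lemma restrict_vertex la m : lev m (path_deg la) -> is_vertex (restrict (val la) m).
Proof. by rewrite -in_box => mb; have /forallP/(_ [` mb]) := valP la. Qed.

Definition path_rng la : vertex D := Sub _ (restrict_vertex (lev0 (path_deg la))).

Definition path_src la : vertex D :=
  Sub _ (restrict_vertex (lev_refl (path_deg la))).

(* A vertex as a function on T(0), which is equal to T. *)
Definition vertex_labelling v : labelling D :=
  Tagged (fun n => {ffun tile_at D n -> 'I_q})
    [ffun i : tile_at D 0 => ev (val v) (val i)].

Lemma restrict_vertex_labelling v : restrict (vertex_labelling v) 0 = val v.
Proof.
apply/ffunP => i; rewrite ffunE addr0 evE; first by rewrite tile_at0 (valP i).
by move=> i0; rewrite ffunE /= evE; congr (val v _); apply/val_inj.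
Qed.

Lemma vertex_labelling_path v : is_path (vertex_labelling v).
Proof.
apply/forallP => -[m mb]; have m0 : lev m 0 by rewrite -in_box.
rewrite [val _]/=.
have -> : m = 0 by move: m0; rewrite lev2 !vE => m0; apply: N2P; rewrite !vE; lia.
by rewrite restrict_vertex_labelling (valP v).
Qed.

Definition vertex_path v : tpath D := Sub _ (vertex_labelling_path v).

End Graph.

Section Laws.
Variable D : basic_data.
Hypothesis inv : invertible_corners D.
Local Notation T := (tile D).
Local Notation q := (modulus D).
Local Notation at_ la p := (ev (tagged la) p).

Implicit Types (la mu nu : tpath D) (v : vertex D) (m n p : NN 2).

Lemma src_rngP mu nu : path_src mu = path_rng nu ->
  restrict (val mu) (path_deg mu) = restrict (val nu) 0.
Proof. by move/(congr1 val). Qed.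

Lemma path_comp_exists mu nu : path_src mu = path_rng nu ->
  exists la : tpath D, is_composite (val mu) (val nu) (val la).
Proof.
move=> h.
have [la pla cla] := composite_exists inv (valP mu) (valP nu) (src_rngP h).
by exists (Sub la pla).
Qed.

(* An arbitrary value when mu and nu are not composable. *)
Definition path_comp mu nu : tpath D :=
  if path_src mu =P path_rng nu is ReflectT h
  then xchoose (path_comp_exists h) else mu.

Lemma path_compP mu nu : path_src mu = path_rng nu ->
  is_composite (val mu) (val nu) (val (path_comp mu nu)).
Proof.
rewrite /path_comp; case: eqP => // h _.
exact: (xchooseP (path_comp_exists h)).
Qed.

Lemma path_comp_unique mu nu la : path_src mu = path_rng nu ->
  is_composite (val mu) (val nu) (val la) -> path_comp mu nu = la.
Proof.
move=> h cla; apply/val_inj.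
exact: (composite_unique inv (valP mu) (valP nu) (valP _) (valP la) (path_compP h) cla).
Qed.

Lemma restrict_ext (x y : labelling D) m n :
  (forall i, i \in T -> at_ x (i + m) = at_ y (i + n)) ->
  restrict x m = restrict y n.
Proof. by move=> H; apply/ffunP => i; rewrite !ffunE H // (valP i). Qed.

Lemma path_deg_comp mu nu : path_src mu = path_rng nu ->
  path_deg (path_comp mu nu) = path_deg mu + path_deg nu.
Proof. by move=> /path_compP/is_compositeP[]. Qed.

Lemma path_rng_comp mu nu : path_src mu = path_rng nu ->
  path_rng (path_comp mu nu) = path_rng mu.
Proof.
move=> /path_compP/is_compositeP[_ H _]; apply/val_inj.
by apply: restrict_ext => i iT; rewrite H // tile_atD // lev0.
Qed.

Lemma path_src_comp mu nu : path_src mu = path_rng nu ->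
  path_src (path_comp mu nu) = path_src nu.
Proof.
move=> h; have /is_compositeP[_ _ H] := path_compP h; apply/val_inj.
apply: restrict_ext => i iT; rewrite path_deg_comp // -H.
  by rewrite addrCA.
by rewrite tile_atD // lev_refl.
Qed.

Lemma path_src_vertex v : path_src (vertex_path v) = v.
Proof. by apply/val_inj; exact: restrict_vertex_labelling. Qed.

Lemma path_rng_vertex v : path_rng (vertex_path v) = v.
Proof. by apply/val_inj; exact: restrict_vertex_labelling. Qed.

Lemma at_vertex v p (pT : p \in T) : at_ (vertex_labelling v) p = val v [` pT].
Proof.
rewrite evE; first by rewrite tile_at0.
by move=> p0; rewrite ffunE /= evE.
Qed.

Lemma val_vertex_path v : val (vertex_path v) = vertex_labelling v.
Proof. by []. Qed.

Lemma path_comp_idl mu : path_comp (vertex_path (path_rng mu)) mu = mu.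
Proof.
apply: path_comp_unique; first exact: path_src_vertex.
rewrite val_vertex_path; apply/is_compositeP; split=> [|p|p _]; rewrite ?add0r // tile_at0 => pT.
by rewrite (at_vertex _ pT) ffunE /= addr0.
Qed.

Lemma path_comp_idr mu : path_comp mu (vertex_path (path_src mu)) = mu.
Proof.
apply: path_comp_unique; first by rewrite path_rng_vertex.
rewrite val_vertex_path; apply/is_compositeP; split=> [|p _|p]; rewrite ?addr0 // tile_at0 => pT.
by rewrite (at_vertex _ pT) ffunE /= addrC.
Qed.

Lemma path_factor la m n : path_deg la = m + n ->
  exists mu nu, [/\ path_deg mu = m, path_deg nu = n, path_src mu = path_rng nu
    & la = path_comp mu nu].
Proof.
move=> laE.
have s1 : is_path (segment (val la) 0 m).
  by apply: segment_path (valP la) (lev0 _) _; rewrite [tag _]laE lev_addr.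
have s2 : is_path (segment (val la) m (m + n)).
  by apply: segment_path (valP la) (lev_addr _ _) _; rewrite [tag _]laE lev_refl.
pose mu : tpath D := Sub _ s1; pose nu : tpath D := Sub _ s2.
have dmu : path_deg mu = m by rewrite /path_deg /= subv0.
have dnu : path_deg nu = n by rewrite /path_deg /= addvK.
have h : path_src mu = path_rng nu.
  apply/val_inj/restrict_ext => i iT; rewrite dmu !at_seg ?add0r ?addr0.
  - by rewrite addrC.
  - by rewrite -[i]addr0 tile_atD // lev0.
  - by rewrite tile_atD // subv0 lev_refl.
exists mu, nu; split=> //; apply/esym/path_comp_unique => //.
rewrite /is_composite -/(path_deg mu) -/(path_deg nu) dmu dnu.
by rewrite -/(path_deg la) laE !eqxx.
Qed.

Lemma path_unique_factorization la m n : path_deg la = m + n ->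
  exists! p : tpath D * tpath D,
    [/\ path_deg p.1 = m, path_deg p.2 = n, path_src p.1 = path_rng p.2
      & la = path_comp p.1 p.2].
Proof.
move=> laE; have [mu [nu [dmu dnu h laC]]] := path_factor laE.
exists (mu, nu); split=> // -[mu' nu'] /= [dmu' dnu' h' laC'].
have /and3P[_ /eqP e1 /eqP e2] := path_compP h.
have /and3P[_ /eqP e1' /eqP e2'] := path_compP h'.
rewrite -/(path_deg mu) -/(path_deg nu) dmu dnu -laC in e1 e2.
rewrite -/(path_deg mu') -/(path_deg nu') dmu' dnu' -laC' in e1' e2'.
by congr pair; apply/val_inj; rewrite -?e1 -?e2 -?e1' -?e2'.
Qed.

Lemma path_comp_assoc la mu nu :
  path_src la = path_rng mu -> path_src mu = path_rng nu ->
  path_comp la (path_comp mu nu) = path_comp (path_comp la mu) nu.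
Proof.
move=> h1 h2.
have h3 : path_src la = path_rng (path_comp mu nu) by rewrite path_rng_comp.
have h4 : path_src (path_comp la mu) = path_rng nu by rewrite path_src_comp.
have d3 : path_deg (path_comp la (path_comp mu nu))
  = path_deg la + (path_deg mu + path_deg nu) by rewrite !path_deg_comp.
have /is_compositeP[t1 a1 b1] := path_compP h1.
have /is_compositeP[t2 a2 b2] := path_compP h2.
have /is_compositeP[t3 a3 b3] := path_compP h3.
apply/esym/path_comp_unique => //; apply/is_compositeP.
rewrite -!/(path_deg _) in t1 t2 t3 a1 a2 a3 b1 b2 b3 *.
split; first by rewrite d3 path_deg_comp // addrA.
  move=> p pm'; have pm : p \in tile_at D (path_deg la + path_deg mu).
    by rewrite -(path_deg_comp h1).
  suff E : segment (val (path_comp la (path_comp mu nu))) 0 (path_deg la + path_deg mu)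
       = val (path_comp la mu).
    by have := congr1 (fun x : labelling D => at_ x p) E; rewrite at_seg ?subv0 // add0r.
  have s : is_path (segment (val (path_comp la (path_comp mu nu))) 0
                      (path_deg la + path_deg mu)).
    apply: segment_path (valP _) (lev0 _) _.
    by rewrite -/(path_deg _) d3 addrA lev_addr.
  apply: (composite_unique inv (valP la) (valP mu) s (valP _) _ (path_compP h1)).
  apply/is_compositeP; split=> [|x xm|x xm]; first exact: subv0.
    rewrite at_seg ?subv0 ?add0r ?a3 //.
    by apply: tile_at_le xm; apply: lev_addr.
  rewrite at_seg ?subv0 ?add0r; last exact: tile_at_shift.
  by rewrite b3 ?a2 // t2; apply: tile_at_le xm; apply: lev_addr.
move=> p pn; rewrite [path_deg (path_comp la mu)]path_deg_comp // -addrA b3 ?b2 //.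
by rewrite t2; apply: tile_at_shift.
Qed.

(* The 2-graph Lambda(T, q, t, w). *)
Definition tile_graph : kgraph 2 :=
  @KGraph 2 (vertex D) (tpath D) (@path_src D) (@path_rng D) (@vertex_path D)
    path_comp (@path_deg D)
    path_src_vertex path_rng_vertex path_src_comp path_rng_comp
    path_comp_idl path_comp_idr path_comp_assoc (fun=> erefl) path_deg_comp
    path_unique_factorization.

End Laws.

(* Main.v *)
Require Import Defs.
From mathcomp Require Import all_boot all_order all_algebra.
From mathcomp Require Import finmap zify.

Set Implicit Arguments.
Unset Strict Implicit.
Unset Printing Implicit Defensive.

Import GRing.Theory.

Local Open Scope fset_scope.
Local Open Scope ring_scope.

(** Write e_i, e_j for the two unit vectors, with i <> j, and w for the rule.
A pair of edges (ei, ej) with a common source is completed by a pair (fi, fj)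
with fi ej = fj ei exactly when there is a path la of degree e_i + e_j whose
final segments of degree e_i and e_j are ei and ej; unique factorization makes
la and (fi, fj) determine each other.  The segments ej and ei prescribe la on
e_i + T(e_j) and on e_j + T(e_i).  These two sets meet in e_i + e_j + T, where
the prescriptions agree because the sources do [fill_square], and, the tile
being hereditary, they cover every point of T(e_i + e_j) except the origin
[tile_at_pred, square_eq_off0].  The translates of the tile by e_i, e_j and
e_i + e_j avoid the origin, so their constraints are inherited from the edges
[valid_square].  One unknown x = la(0) and one equation remain:

    w(0) x + (a sum over the other points of the tile) = t  in Z/qZ.

If w(0) is invertible, this equation has exactly one solution.

Conversely, every x occurs as the value at the origin of some path la of degree
e_i + e_j [exists_path_at0].  If w(0) x = w(0) y, then changing that value to y
gives another path with the same final edges, so 1-coalignment forces the two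
paths to be equal and x = y.  Multiplication by w(0) is then injective on the
finite set Z/qZ, hence surjective, and 1 is one of its values. *)

(** * Labellings of N^2 and the paths they carry *)

Definition tile_sum D (F : NN 2 -> 'I_(modulus D)) (a : NN 2) : nat :=
  \sum_(i : tile D) rule D i * F (val i + a)%R.

Definition valid_at D (F : NN 2 -> 'I_(modulus D)) (a : NN 2) : bool :=
  (tile_sum F a == trace D %[mod modulus D])%N.

Definition path_at D (la : tpath D) (p : NN 2) : 'I_(modulus D) :=
  ev (tagged (val la)) p.

Lemma path_at_valid D (la : tpath D) a : lev a (path_deg la) ->
  valid_at (path_at la) a.
Proof. exact: (is_pathP _ (valP la)). Qed.

Lemma tpath_eq D (la mu : tpath D) : path_deg la = path_deg mu ->
  (forall p, p \in tile_at D (path_deg la) -> path_at la p = path_at mu p) ->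
  la = mu.
Proof. by move=> dE aE; apply/val_inj/lab_eq. Qed.

Lemma eq_tile_sum D (F G : NN 2 -> 'I_(modulus D)) a :
  (forall i, i \in tile D -> F (i + a) = G (i + a)) ->
  tile_sum F a = tile_sum G a.
Proof. by move=> FG; apply: eq_bigr => i _; rewrite FG ?(valP i). Qed.

Lemma valid_at_shift D (F G : NN 2 -> 'I_(modulus D)) m a :
  (forall i, i \in tile D -> F (m + (i + a)) = G (i + a)) ->
  valid_at F (m + a) = valid_at G a.
Proof.
move=> FG; rewrite /valid_at /tile_sum; congr (_ %% _ == _)%N.
by apply: eq_bigr => i _; rewrite addrCA FG ?(valP i).
Qed.

(** The constraint at [a] only reads the labels on [a + T], so it can be read
off any path that [F] contains as a translate. *)
Lemma valid_at_subpath D (F : NN 2 -> 'I_(modulus D)) (la : tpath D) m a :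
  (forall p, p \in tile_at D (path_deg la) -> F (m + p) = path_at la p) ->
  lev m a -> lev a (m + path_deg la) -> valid_at F a.
Proof.
move=> Fla ma an.
have ra : lev (subv a m) (path_deg la).
  by apply/levP => l; have /levP/(_ l) := an; rewrite !vE; lia.
rewrite -(subvK ma) (@valid_at_shift _ F (path_at la)).
  exact: path_at_valid.
by move=> i iT; apply: Fla; apply: tile_atD.
Qed.

Lemma path_of_valid D n (F : NN 2 -> 'I_(modulus D)) :
  (forall a, lev a n -> valid_at F a) ->
  exists2 la : tpath D, path_deg la = n
    & forall p, p \in tile_at D n -> path_at la p = F p.
Proof.
move=> Fv.
pose la : labelling D := Tagged (fun n => {ffun tile_at D n -> 'I_(modulus D)})
  [ffun i : tile_at D n => F (val i)].
have laF p : p \in tile_at D n -> ev (tagged la) p = F p.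
  by move=> pn; rewrite evE ffunE.
have pla : is_path la.
  apply/is_pathP => a an; rewrite (@constr_ext _ _ F); first exact: Fv.
  by move=> i iT; apply: laF; apply: tile_atD.
by exists (Sub la pla).
Qed.

Lemma path_comp_at D (hD : invertible_corners D) (mu nu : tpath D) p :
  path_src mu = path_rng nu -> p \in tile_at D (path_deg nu) ->
  path_at (path_comp hD mu nu) (path_deg mu + p) = path_at nu p.
Proof. by move=> /(path_compP hD)/is_compositeP[_ _ H] /H. Qed.

Lemma lev_unitv k (l : 'I_k) (p : NN k) : lev (unitv l) p = (0 < p l)%N.
Proof.
apply/levP/idP => [/(_ l)|pl j]; first by rewrite ffunE eqxx.
by rewrite ffunE; case: eqP => [->|].
Qed.

(** This is where heredity enters: a step down from [p] is taken either from
the translation or, if that has no [l]-component, from the point of the tile. *)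
Lemma tile_at_pred D n l p : p \in tile_at D n ->
  subv p (unitv l) \in tile_at D (subv n (unitv l)).
Proof.
case/tile_atP => m [/levP mn /levP mp pT]; apply/tile_atP.
exists (subv m (unitv l)); split.
- by apply/levP => j; rewrite !vE; have := mn j; lia.
- by apply/levP => j; rewrite !vE; have := mp j; lia.
- apply: tile_hereditary pT _; apply/levP => j; rewrite !vE; have := mp j; lia.
Qed.

Lemma zero_in_tile_at D n : 0 \in tile_at D n.
Proof. by rewrite (tile_at_le (lev0 n)) // tile_at0 zero_in_tile. Qed.

Lemma lex_le (x y z w k : nat) :
  (x * k.+1 + z <= y * k.+1 + w)%N -> (w <= k)%N -> (x <= y)%N.
Proof.
move=> le_xy wk; rewrite leqNgt; apply/negP => yx.
by have := leq_mul yx (leqnn k.+1); lia.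
Qed.

(** Every translate [a + T] with [a <= n] can be satisfied by adjusting the label
at its corner [c_1 e_1 + a].  Taking the translates by increasing first
coordinate, and by decreasing second coordinate within a column, no corner meets
an earlier translate.  As [c_1 > 0], the origin is never a corner, so its label
is free. *)
Lemma exists_path_at0 D (hD : invertible_corners D) n (x : 'I_(modulus D)) :
  exists2 la : tpath D, path_deg la = n & path_at la 0 = x.
Proof.
(* A numerical key for that order on the box of all a <= n. *)
pose rank (a : NN 2) := (a ord0 * (n ord_max).+1 + (n ord_max - a ord_max))%N.
pose le_rank a b := (rank a <= rank b)%N.
pose s := sort le_rank (enum_fset (box n)).
have mem_s a : (a \in s) = lev a n.
  by rewrite mem_sort -[a \in enum_fset _]/(a \in box _) in_box.
have sorted_s : pairwise (fun a b => le_rank a b && (a != b)) s.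
  rewrite pairwise_relI -uniq_pairwise sort_uniq fset_uniq andbT.
  rewrite -sorted_pairwise; last by move=> a b c; apply: leq_trans.
  by apply: sort_sorted => a b; apply: leq_total.
have corner_free (a b : NN 2) : lev a n -> lev b n -> le_rank a b && (a != b) ->
    [forall i : tile D, val i + a != corner D ord0 + b].
  rewrite !lev2 => an bn /andP[ab nab].
  apply/forallP => -[i iT]; apply: contraNneq nab => /= /ffunP E.
  have := E ord0; have := E ord_max; have := tile_bound ord0 iT.
  rewrite !vE !cornerE /= => i0 e1 e0; apply/eqP.
  have e : a ord0 = b ord0.
    have : (a ord0 <= b ord0)%N := lex_le ab (leq_subr _ _).
    lia.
  by move: ab; rewrite /le_rank /rank e leq_add2l => ab; apply: N2P; lia.
have free_corner : pairwise
    (fun a b => [forall i : tile D, val i + a != corner D ord0 + b]) s.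
  apply: (sub_in_pairwise _ _ sorted_s (P := mem s)); last exact/allP.
  by move=> a b; rewrite -![_ \in mem s]/(_ \in s) !mem_s; apply: corner_free.
have [G [Gv G0]] := @fill_exists D hD (fun=> ord0) s (fun=> x) free_corner.
have [|la dla laG] := @path_of_valid D n G.
  by move=> a an; apply: Gv; rewrite mem_s.
exists la; rewrite // laG ?zero_in_tile_at //.
apply: G0 => a _; apply/eqP => /ffunP/(_ ord0); rewrite !vE cornerE /=.
by have := tile_join_gt0 D ord0; lia.
Qed.

Definition at_origin D (x : 'I_(modulus D)) (F : NN 2 -> 'I_(modulus D))
    (p : NN 2) : 'I_(modulus D) :=
  if p == 0 then x else F p.

Lemma tile_sum_at_origin D x (F : NN 2 -> 'I_(modulus D)) :
  tile_sum (at_origin x F) 0 =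
  (rule D [` zero_in_tile D] * x
   + \sum_(i : tile D | i != [` zero_in_tile D]) rule D i * F (val i))%N.
Proof.
rewrite /tile_sum (bigD1 [` zero_in_tile D]) //= /at_origin addr0 eqxx.
congr (_ + _)%N; apply: eq_bigr => i; rewrite -val_eqE /= => i0.
by rewrite addr0 (negbTE i0).
Qed.

Lemma vec_neq0 k (p : NN k) : p != 0 -> exists l, (0 < p l)%N.
Proof.
move=> p0; case: (pickP (fun l => 0 < p l)%N) => [l pl|H]; first by exists l.
by case/eqP: p0; apply/ffunP => l; rewrite zerovE; case: (p l) (H l).
Qed.

Lemma addv_eq0 k (m p : NN k) : (m + p == 0) = (m == 0) && (p == 0).
Proof.
apply/eqP/andP => [/ffunP E|[/eqP-> /eqP->]]; last by rewrite addr0.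
split; apply/eqP/ffunP => l; rewrite zerovE.
  by have /eqP := E l; rewrite !vE addn_eq0 => /andP[/eqP].
by have /eqP := E l; rewrite !vE addn_eq0 => /andP[_ /eqP].
Qed.

Lemma valid_at_origin_neq0 D x (F : NN 2 -> 'I_(modulus D)) a : a != 0 ->
  valid_at (at_origin x F) a = valid_at F a.
Proof.
move=> a0; apply: constr_ext => i _.
by rewrite /at_origin addv_eq0 (negbTE a0) andbF.
Qed.

Lemma unitv_neq0 k (l : 'I_k) : unitv l != 0.
Proof. by apply/eqP => /ffunP/(_ l); rewrite !ffunE eqxx. Qed.

Lemma at_origin_unitvD D x (F : NN 2 -> 'I_(modulus D)) l p :
  at_origin x F (unitv l + p) = F (unitv l + p).
Proof. by rewrite /at_origin addv_eq0 (negbTE (unitv_neq0 l)). Qed.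

(** * Commuting squares of edges *)

Lemma ord2_neq (i j l : 'I_2) : i != j -> l = i \/ l = j.
Proof.
case: i j l => [[|[|//]] ?] [[|[|//]] ?] [[|[|//]] ?] //= _;
  by [left; apply/val_inj|right; apply/val_inj].
Qed.

Lemma square_neq0 (i j : 'I_2) (p : NN 2) : i != j -> p != 0 ->
  (0 < p i)%N \/ (0 < p j)%N.
Proof.
by move=> ij /vec_neq0[l]; case: (ord2_neq l ij) => ->; [left|right].
Qed.

(** The two edges overlap only in [e_i + e_j + T], that is in their sources. *)
Lemma fill_square D (i j : 'I_2) (ei ej : tpath D) : i != j ->
  path_deg ei = unitv i -> path_deg ej = unitv j -> path_src ei = path_src ej ->
  exists F : NN 2 -> 'I_(modulus D),
    (forall p, p \in tile_at D (unitv j) -> F (unitv i + p) = path_at ej p) /\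
    (forall p, p \in tile_at D (unitv i) -> F (unitv j + p) = path_at ei p).
Proof.
move=> ij di dj sE.
exists (fun p : NN 2 => if (0 < p i)%N then path_at ej (subv p (unitv i))
                 else path_at ei (subv p (unitv j))); split=> p pT.
  by rewrite addvE ffunE eqxx addvK.
rewrite addvE ffunE (negbTE ij) add0n; case: ifP => pi; last by rewrite addvK.
have /subvK pE : lev (unitv i) p by rewrite lev_unitv.
have rT : subv p (unitv i) \in tile D.
  rewrite -tile_at0; have := tile_at_pred i pT.
  by rewrite (_ : subv (unitv i) (unitv i) = 0) // -[X in subv X _]addr0 addvK.
have /(congr1 val)/ffunP/(_ [` rT]) := sE; rewrite !ffunE /= di dj => E.
rewrite -{1 2}pE addrCA addvK [X in _ = path_at _ X]addrC.
by rewrite /path_at E addrC.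
Qed.

(** The origin is the only point of [T(e_i + e_j)] that neither final edge sees:
any other point has a positive coordinate, [i] or [j], along which it can be
stepped down. *)
Lemma square_eq_off0 D (F G : NN 2 -> 'I_(modulus D)) (i j : 'I_2) : i != j ->
  (forall p, p \in tile_at D (unitv j) -> F (unitv i + p) = G (unitv i + p)) ->
  (forall p, p \in tile_at D (unitv i) -> F (unitv j + p) = G (unitv j + p)) ->
  forall p, p \in tile_at D (unitv i + unitv j) -> p != 0 -> F p = G p.
Proof.
move=> ij Fi Fj p pT /(square_neq0 ij) [] pl.
  have := tile_at_pred i pT; rewrite addvK => /Fi.
  by rewrite subvK // lev_unitv.
have := tile_at_pred j pT; rewrite [unitv i + _]addrC addvK => /Fj.
by rewrite subvK // lev_unitv.
Qed.

(** Only the constraint at the origin is not already part of an edge. *)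
Lemma valid_square D (i j : 'I_2) (ei ej : tpath D) F : i != j ->
  path_deg ei = unitv i -> path_deg ej = unitv j ->
  (forall p, p \in tile_at D (unitv j) -> F (unitv i + p) = path_at ej p) ->
  (forall p, p \in tile_at D (unitv i) -> F (unitv j + p) = path_at ei p) ->
  forall a, lev a (unitv i + unitv j) -> a != 0 -> valid_at F a.
Proof.
move=> ij di dj Fj Fi a au /(square_neq0 ij) [] al.
  by apply: (@valid_at_subpath _ F ej (unitv i)); rewrite ?dj ?lev_unitv.
apply: (@valid_at_subpath _ F ei (unitv j)); rewrite ?di ?lev_unitv //.
by rewrite addrC.
Qed.

Lemma factor_at D (hD : invertible_corners D) (la : tpath D) m n :
  path_deg la = m + n ->
  exists mu nu : tpath D,
    [/\ path_deg mu = m, path_deg nu = n, path_src mu = path_rng nu,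
        la = path_comp hD mu nu
      & forall p, p \in tile_at D n -> path_at nu p = path_at la (m + p)].
Proof.
move=> /(path_factor hD) [mu [nu [dm dn h ->]]]; exists mu, nu; split=> // p pn.
by rewrite -dm path_comp_at // dn.
Qed.

Lemma path_comp_at_left D (hD : invertible_corners D) (mu nu : tpath D) p :
  path_src mu = path_rng nu -> p \in tile_at D (path_deg mu) ->
  path_at (path_comp hD mu nu) p = path_at mu p.
Proof. by move=> /(path_compP hD)/is_compositeP[_ H _] /H. Qed.

Lemma path_comp_injl D (hD : invertible_corners D) (mu mu' nu : tpath D) :
  path_deg mu = path_deg mu' ->
  path_src mu = path_rng nu -> path_src mu' = path_rng nu ->
  path_comp hD mu nu = path_comp hD mu' nu -> mu = mu'.
Proof.
move=> dE h h' E; apply: tpath_eq => // p pm.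
by rewrite -(path_comp_at_left hD h pm) E path_comp_at_left // -dE.
Qed.

(** * The unknown at the origin *)

(** The other points of [0 + T] being common, the constraint at the origin
reduces to cancelling [w(0)]. *)
Lemma tpath_eq_off0 D (la la' : tpath D) :
  invertible_mod (rule D [` zero_in_tile D]) ->
  path_deg la = path_deg la' ->
  (forall p, p \in tile_at D (path_deg la) -> p != 0 ->
    path_at la p = path_at la' p) ->
  la = la'.
Proof.
move=> w0_inv dE off0; apply: tpath_eq => // p pT.
have [->|/off0->//] := eqVneq p 0.
have sum_la : tile_sum (path_at la) 0 =
    tile_sum (at_origin (path_at la 0) (path_at la)) 0.
  by apply: eq_tile_sum => i _; rewrite /at_origin; case: eqP => [->|].
have sum_la' : tile_sum (path_at la') 0 =
    tile_sum (at_origin (path_at la' 0) (path_at la)) 0.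
  apply: eq_tile_sum => i iT; rewrite /at_origin; case: eqP => [->//|/eqP i0].
  by rewrite off0 // tile_atD ?lev0.
have /eqP v := path_at_valid (lev0 (path_deg la)).
have /eqP v' := path_at_valid (lev0 (path_deg la')).
move: (etrans v (esym v')); rewrite sum_la sum_la' !tile_sum_at_origin.
exact: cancel_mod.
Qed.

(** Two paths of degree (1,1) that differ at most at the origin have the same
final edges, so they complete the same pair of edges. *)
Lemma one_coaligned_cancel D (hD : invertible_corners D)
    (x y : 'I_(modulus D)) :
  one_coaligned (tile_graph hD) ->
  (rule D [` zero_in_tile D] * x = rule D [` zero_in_tile D] * y
    %[mod modulus D])%N ->
  x = y.
Proof.
move=> coal wxy; pose i : 'I_2 := ord0; pose j : 'I_2 := ord_max.
have [la dla la0] := exists_path_at0 hD (unitv i + unitv j) x.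
have laE : path_at la =1 at_origin x (path_at la).
  by move=> p; rewrite /at_origin; case: eqP => [->|].
have [|la' dla' la'E] := @path_of_valid D (unitv i + unitv j)
    (at_origin y (path_at la)).
  move=> a au; have [->|a0] := eqVneq a 0.
    have := path_at_valid (lev0 (path_deg la)).
    rewrite /valid_at tile_sum_at_origin -modnDml -wxy modnDml.
    rewrite -tile_sum_at_origin; congr (_ %% _ == _)%N.
    by apply: eq_tile_sum => r _; rewrite laE.
  by rewrite valid_at_origin_neq0 //; apply: path_at_valid; rewrite dla.
have dlaC : path_deg la = unitv j + unitv i by rewrite addrC.
have dlaC' : path_deg la' = unitv j + unitv i by rewrite addrC.
have [fi [ej [dfi dej hi laij ejE]]] := factor_at hD dla.
have [fj [ei [dfj dei hj laji eiE]]] := factor_at hD dlaC.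
have [fi' [ej' [dfi' dej' hi' laij' ejE']]] := factor_at hD dla'.
have [fj' [ei' [dfj' dei' hj' laji' eiE']]] := factor_at hD dlaC'.
have ej_eq : ej' = ej.
  apply: tpath_eq; rewrite dej' // => p pT; rewrite ejE' // ejE //.
  by rewrite la'E ?tile_at_shift // at_origin_unitvD.
have ei_eq : ei' = ei.
  apply: tpath_eq; rewrite dei' // => p pT; rewrite eiE' // eiE //.
  rewrite la'E ?at_origin_unitvD //.
  by rewrite [unitv i + unitv j]addrC tile_at_shift.
subst ej' ei'.
have sE : path_src ei = path_src ej.
  by rewrite -(path_src_comp hD hi) -laij laji path_src_comp.
have [f [_ f_uniq]] := coal i j isT ei ej dei dej sE.
have /= [fi_eq _] : (fi, fj) = (fi', fj').
  by rewrite -(f_uniq (fi, fj)) ?(f_uniq (fi', fj')) //; split=> //=;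
    rewrite -?laij -?laij'.
have la_eq : la = la' by rewrite laij laij' fi_eq.
by rewrite -la0 la_eq la'E ?zero_in_tile_at // /at_origin eqxx.
Qed.

Lemma invertible_mod_of_cancel q (w : 'I_q) :
  (forall x y : 'I_q, (w * x = w * y %[mod q])%N -> x = y) -> invertible_mod w.
Proof.
move=> w_cancel; have q0 : (0 < q)%N := leq_ltn_trans (leq0n _) (ltn_ord w).
pose mul_w (x : 'I_q) := Ordinal (ltn_pmod (w * x) q0).
have mul_w_inj : injective mul_w.
  by move=> x y /(congr1 val); apply: w_cancel.
pose one := Ordinal (ltn_pmod 1 q0).
by exists (invF mul_w_inj one); apply: (congr1 val (f_invF mul_w_inj one)).
Qed.

Lemma one_coaligned_of_invertible D (hD : invertible_corners D) :
  invertible_mod (rule D [` zero_in_tile D]) -> one_coaligned (tile_graph hD).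
Proof.
move=> w0_inv i j ij ei ej /= dei dej sE.
have [F [Fj Fi]] := fill_square ij dei dej sE.
have [x xE] := solve_mod
  (\sum_(r : tile D | r != [` zero_in_tile D]) rule D r * F (val r))%N
  (trace D) w0_inv.
have [|la dla laE] := @path_of_valid D (unitv i + unitv j) (at_origin x F).
  move=> a au; have [->|a0] := eqVneq a 0.
    by rewrite /valid_at tile_sum_at_origin xE.
  by rewrite valid_at_origin_neq0 //; apply: (valid_square ij dei dej Fj Fi).
have dla' : path_deg la = unitv j + unitv i by rewrite addrC.
have laj p : p \in tile_at D (unitv j) -> path_at la (unitv i + p) = path_at ej p.
  by move=> pT; rewrite laE ?tile_at_shift // at_origin_unitvD Fj.
have lai p : p \in tile_at D (unitv i) -> path_at la (unitv j + p) = path_at ei p.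
  move=> pT; rewrite laE ?at_origin_unitvD ?Fi //.
  by rewrite [unitv i + unitv j]addrC tile_at_shift.
have [fi [ej' [dfi dej' hi laij ejE]]] := factor_at hD dla.
have [fj [ei' [dfj dei' hj laji eiE]]] := factor_at hD dla'.
have ej_eq : ej' = ej.
  by apply: tpath_eq; rewrite ?dej' // => p pT; rewrite ejE // laj.
have ei_eq : ei' = ei.
  by apply: tpath_eq; rewrite ?dei' // => p pT; rewrite eiE // lai.
subst ej' ei'.
exists (fi, fj); split; first by split=> //=; rewrite -laij.
case=> gi gj /= [dgi dgj hgi hgj gE].
have laC : la = path_comp hD gi ej.
  apply: tpath_eq_off0 => //; first by rewrite path_deg_comp // dgi dej.
  rewrite dla; apply: square_eq_off0 => // p pT.
    by rewrite laj // -dgi path_comp_at // dej.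
  by rewrite lai // gE -dgj path_comp_at // dei.
congr pair.
  by apply: (@path_comp_injl _ hD _ _ ej); rewrite ?dgi // -laij.
by apply: (@path_comp_injl _ hD _ _ ei); rewrite ?dgj // -laji -gE.
Qed.

Theorem theorem3p1 (D : basic_data) (hD : invertible_corners D) :
  one_coaligned (tile_graph hD) <->
  invertible_mod (rule D [` zero_in_tile D]).
Proof.
split=> [coal|]; last exact: one_coaligned_of_invertible.
by apply: invertible_mod_of_cancel => x y; apply: one_coaligned_cancel coal.
Qed.
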